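(* Let $\mathbf{x}$ be a sequence over a finite alphabet. Then $r_{\mathbf{x}} (n) \leq r_{\mathbf{x}}(n+1) +1$ for all $n \geq 0$.
   Context: A factor of a sequence is a finite contiguous block. For $u=u(1)\cdots u(m)$, $u^R=u(m)\cdots u(1)$. $r_{\mathbf{x}}(n)$ is the number of distinct length-$n$ factors of $\mathbf{x}$ up to the equivalence $u\sim v\iff v\in\{u,u^R\}$. *)

(* Defs.v *)
From mathcomp Require Import all_boot.
From mathcomp Require Import boolp.

Set Implicit Arguments.
Unset Strict Implicit.
Unset Printing Implicit Defensive.

Section ReflectionComplexity.
Variables (A : finType) (x : nat -> A).

Definition block (i n : nat) : n.-tuple A := [tuple x (i + j) | j < n].

(* Occurrence at some position is an unbounded existential, hence the
   classical boolean view [asbool]. *)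
Definition factors (n : nat) : {set n.-tuple A} :=
  [set u | `[< exists i : nat, u = block i n >]].

Definition refl_equiv (n : nat) : rel (n.-tuple A) :=
  fun u v => v \in [:: u; [tuple of rev u]].

(* Only factors of x are put into classes: the class of u is {u} when the
   reversal of u is not itself a factor. *)
Definition reflection_complexity (n : nat) : nat :=
  #|equivalence_partition (@refl_equiv n) (factors n)|.

End ReflectionComplexity.

Lemma refl_equiv_equivalence (A : finType) (n : nat) :
  equivalence_rel (@refl_equiv A n).
Proof.
have revK (u : n.-tuple A) : [tuple of rev [tuple of rev u]] = u.
  by apply: val_inj; rewrite /= revK.
move=> u v w; rewrite /refl_equiv !inE eqxx; split=> //.
by case/orP=> /eqP-> //; rewrite revK orbC.
Qed.

(* Main.v *)
(** The walk through the positions of [x] makes the graph with vertices the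
    reflection classes of length-[n] factors and edges the reflection classes
    of length-[n.+1] factors connected: reversing a length-[n.+1] factor only
    swaps the classes of its prefix and suffix. A connected graph has at most
    one more vertex than edges. *)

Require Import Defs.
From mathcomp Require Import all_boot.
From mathcomp Require Import boolp zify.

Set Implicit Arguments.
Unset Strict Implicit.
Unset Printing Implicit Defensive.

(* Every vertex other than [f 0] is charged to the edge along which the walk
   first enters it; two distinct vertices charged to the same edge would each
   be visited strictly before the other. *)
Lemma card_walk_le (T U : finType) (f : nat -> T) (g : nat -> U)
    (B : {set T}) (C : {set U}) :
  (forall c, c \in B -> exists i, f i = c) ->
  (forall i, g i \in C) ->
  (forall i j, g i = g j ->
    f i.+1 = f j.+1 \/ f i.+1 = f j /\ f i = f j.+1) ->
  #|B| <= #|C| + 1.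
Proof.
move=> fB gC fg.
(* [p c] is the time of the first visit to [c]; it is arbitrary outside [B]. *)
have [|p pP] := @boolp.choice T nat (fun c k =>
    c \in B -> f k = c /\ forall j, f j = c -> k <= j).
  move=> c.
  have [cB|_] := boolP (c \in B); last by exists 0.
  have ex : exists i, f i == c by have [i <-] := fB c cB; exists i.
  exists (ex_minn ex) => _; case: ex_minnP => i /eqP fi imin.
  by split=> // j /eqP/imin.
rewrite (cardsD1 (f 0) B) addnC leq_add ?leq_b1 //.
(* Edge [g k] leads from [f k] to [f k.+1], hence the predecessor; it is genuine since [c] differs
   from [f 0]. *)
have h_inj : {in B :\ f 0 &, injective (fun c => g (p c).-1)}.
  move=> c d; rewrite !inE => /andP[c0 cB] /andP[d0 dB].
  have [fc cmin] := pP c cB; have [fd dmin] := pP d dB.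
  have: p c != 0 by apply: contraNneq c0 => pc0; rewrite -fc pc0.
  have: p d != 0 by apply: contraNneq d0 => pd0; rewrite -fd pd0.
  case: (p c) (p d) fc cmin fd dmin => [|i] [|j] //= fc cmin fd dmin _ _.
  case/fg => [|[fij fji]]; first by rewrite fc fd.
  have := cmin j; have := dmin i; rewrite -fij fc -fd fji => /(_ erefl) ji.
  by move=> /(_ erefl); lia.
rewrite -(card_in_imset h_inj); apply/subset_leq_card/subsetP => _ /imsetP[c _ ->].
exact: gC.
Qed.

Section ReflectionClass.
Variables (A : finType) (x : nat -> A).

Lemma refl_equiv_blockP (n i j : nat) :
  reflect ((forall k, k < n -> x (j + k) = x (i + k)) \/
           (forall k, k < n -> x (j + k) = x (i + (n - k.+1))))
    (refl_equiv (block x i n) (block x j n)).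
Proof.
have revE (k : 'I_n) :
    tnth [tuple of rev (block x i n)] k = x (i + (n - k.+1)).
  have kn : n - k.+1 < n by have := ltn_ord k; lia.
  (* [x 0] is only a default letter: all indices are in range. *)
  rewrite (tnth_nth (x 0)) nth_rev size_tuple //.
  by rewrite -(tnth_nth (x 0) (block x i n) (Ordinal kn)) tnth_mktuple.
rewrite /refl_equiv !inE; apply: (iffP orP) => [] [].
- move=> /eqP e; left=> k kn.
  by have := congr1 (fun t => tnth t (Ordinal kn)) e; rewrite !tnth_mktuple.
- move=> /eqP e; right=> k kn.
  have := congr1 (fun t => tnth t (Ordinal kn)) e.
  by rewrite /block tnth_mktuple revE.
- by move=> e; left; apply/eqP/eq_from_tnth => k; rewrite !tnth_mktuple e.
- move=> e; right; apply/eqP/eq_from_tnth => k.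
  by rewrite revE tnth_mktuple e.
Qed.

(** Indexed by position rather than by word, so that [refl_class n] is itself the walk on vertices
    and [refl_class n.+1] its sequence of edges. *)
Definition refl_class (n i : nat) : {set n.-tuple A} :=
  [set v in factors x n | refl_equiv (block x i n) v].

Lemma block_factors (n i : nat) : block x i n \in factors x n.
Proof. by rewrite inE; apply/asboolP; exists i. Qed.

Lemma refl_classP (n i j : nat) :
  reflect (refl_class n i = refl_class n j)
    (refl_equiv (block x i n) (block x j n)).
Proof.
apply: (iffP idP) => [ij|eij].
  apply/setP => v; rewrite !inE; congr (_ && _).
  by have [_ /(_ ij)] := refl_equiv_equivalence (block x i n) (block x j n) v.
have : block x j n \in refl_class n j.
  rewrite inE block_factors /=.
  by have [] := refl_equiv_equivalence (block x j n) (block x j n) (block x j n).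
by rewrite -eij inE => /andP[].
Qed.

Lemma refl_class_partition (n i : nat) :
  refl_class n i \in equivalence_partition (@refl_equiv A n) (factors x n).
Proof. by apply/imsetP; exists (block x i n); rewrite ?block_factors. Qed.

Lemma partition_refl_class (n : nat) c :
  c \in equivalence_partition (@refl_equiv A n) (factors x n) ->
  exists i, refl_class n i = c.
Proof.
case/imsetP => u; rewrite inE => /asboolP[i ->] ->.
by exists i.
Qed.

Lemma refl_class_endpoints (n i j : nat) :
  refl_class n.+1 i = refl_class n.+1 j ->
  refl_class n i.+1 = refl_class n j.+1 \/
  refl_class n i.+1 = refl_class n j /\ refl_class n i = refl_class n j.+1.
Proof.
move=> /refl_classP/refl_equiv_blockP[] e; [left|right; split];
  apply/refl_classP/refl_equiv_blockP; [left|right|right] => k kn.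
- by rewrite !addSnnS e.
(* Reversal on length [n.+1] pairs offset [k] with [n - k], which equals [(n - k.+1).+1] because
   [k < n]: the shift from prefix to suffix. *)
- by rewrite e; [congr x|]; lia.
- by rewrite addSnnS e; [congr x|]; lia.
Qed.

End ReflectionClass.

Theorem theorem4p1 (A : finType) (x : nat -> A) (n : nat) :
  reflection_complexity x n <= reflection_complexity x n.+1 + 1.
Proof.
apply: (@card_walk_le _ _ (refl_class x n) (refl_class x n.+1)).
- exact: partition_refl_class.
- exact: refl_class_partition.
- exact: refl_class_endpoints.
Qed.
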